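(* There is no $(4,3,-2)$-graph, i.e., no graph of maximum degree $4$, diameter $3$ and order $M(4,3)-2=51$.
   Context: All graphs are simple. For integers $\Delta\ge 2$, $D\ge 1$, the Moore bound is $M(\Delta,D)=1+\Delta\left(1+(\Delta-1)+\dots+(\Delta-1)^{D-1}\right)$. For $\epsilon\ge 0$, a $(\Delta,D,-\epsilon)$-graph is a graph of maximum degree $\Delta$, diameter $D$, and order exactly $M(\Delta,D)-\epsilon$. *)

(* Defs.v *)
From mathcomp Require Import all_boot.

Set Implicit Arguments.
Unset Strict Implicit.
Unset Printing Implicit Defensive.

Definition simple_graph (T : finType) (e : rel T) : Prop :=
  symmetric e /\ irreflexive e.

Definition degree (T : finType) (e : rel T) (x : T) : nat :=
  #|[set y | e x y]|.

Definition max_degree (T : finType) (e : rel T) : nat :=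
  \max_(x : T) degree e x.

(* The distance is a relation: vertices in different components have no
   (finite) distance. A walk x :: p has length size p. *)
Definition is_dist (T : finType) (e : rel T) (x y : T) (d : nat) : Prop :=
  (exists p : seq T, [/\ path e x p, last x p = y & size p = d]) /\
  (forall p : seq T, path e x p -> last x p = y -> d <= size p).

(* The diameter is the largest distance; in particular a graph with a (finite)
   diameter is nonempty and connected. *)
Definition has_diameter (T : finType) (e : rel T) (D : nat) : Prop :=
  (forall x y : T, exists2 d, is_dist e x y d & d <= D) /\
  (exists x y : T, is_dist e x y D).

Definition moore_bound (Delta D : nat) : nat :=
  1 + Delta * \sum_(i < D) (Delta - 1) ^ i.

(* A (Delta, D, -eps)-graph. The order condition #|T| = M(Delta, D) - eps is
   written additively because subtraction on nat is truncated. *)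
Definition defect_graph (Delta D eps : nat) (T : finType) (e : rel T) : Prop :=
  [/\ simple_graph e, max_degree e = Delta, has_diameter e D
    & #|T| + eps = moore_bound Delta D].

Lemma moore_bound_4_3 : moore_bound 4 3 = 53.
Proof. by rewrite /moore_bound !big_ord_recl big_ord0. Qed.

(* Main.v *)
Require Import Defs.
From mathcomp Require Import all_boot all_order all_algebra.
From mathcomp Require Import all_fingroup all_solvable.
From mathcomp Require Import zify ring.

(**
Counting balls shows that the graph is 4-regular. If [A] is its adjacency matrix
and [J] the all-ones matrix, then [B := A^3 + A^2 - 6 A - 3 I - J] is a symmetric
nonnegative integer matrix with row sums 2 and even diagonal, hence
[B = P + P^-1] for some permutation matrix [P], and [A] commutes with [B].

Let [N_d] be the number of cycles of [P] whose length is divisible by [d]. If a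
prime field contains an element [z] of order [d] such that
[x^3 + x^2 - 6 x - 3 = z + 1/z] has no root there, then the eigenspace of [B]
for [z + 1/z] (inside the space of vectors of sum 0) is a vector space over a
cubic extension, with scalar action given by [A]; so 3 divides its dimension,
which gives [N_d = 0 mod 3] for [d > 1], and [N_1 = 1 mod 3].

The relation [AB = BA] is a discrete wave equation for the adjacency of
[P^i x] and [P^j y]. Its solutions are sums of two travelling waves, so for
adjacent [x] and [y] either all pairs [P^t x, P^t y] or all pairs
[P^t x, P^(-t) y] are adjacent. As degrees are at most 4, a prime [q >= 5]
dividing the length of one cycle divides the lengths of the neighbouring cycles,
hence all lengths, hence 51. This is needed because for [d = 10] the cubic has a
root over [Q(z + 1/z)].

Every [d <= 51] is covered by one of these two arguments or has a totient
[phi(d)] divisible by 3, so [51 = sum_d phi(d) N_d = 1 mod 3], a contradiction.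
*)

Set Implicit Arguments.
Unset Strict Implicit.
Unset Printing Implicit Defensive.

Import GRing.Theory.

(** * Distance at most 3 and regularity *)

Definition within3 (T : finType) (e : rel T) := forall x y : T,
  [\/ x = y, e x y, exists2 a, e x a & e a y
    | exists a b, [/\ e x a, e a b & e b y]].

Lemma diameter3_within3 (T : finType) (e : rel T) :
  has_diameter e 3 -> within3 e.
Proof.
move=> [dist3 _] x y; have [d [[p [xp py pd]] _] d3] := dist3 x y.
rewrite -{}pd in d3.
case: p xp py d3 => [|a [|b [|c [|//]]]] /=; first by constructor 1.
- by rewrite andbT => xa <- _; constructor 2.
- by case/and3P=> xa ab _ <- _; constructor 3; exists a.
- by case/and4P=> xa ab bc _ <- _; constructor 4; exists a, b.
Qed.

Lemma card_bigcup_leq (I T : finType) (A : {set I}) (F : I -> {set T}) k :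
  (forall i, i \in A -> #|F i| <= k) -> #|\bigcup_(i in A) F i| <= #|A| * k.
Proof.
move=> Fk; rewrite -sum_nat_const.
have Fs : \sum_(i in A) #|F i| <= \sum_(i in A) k by apply: leq_sum.
apply: leq_trans Fs.
elim/big_rec2: _ => [|i n B _ nB]; first by rewrite cards0.
by rewrite (leq_trans (leq_card_setU _ _)) ?leq_add.
Qed.

(** A walk that does not turn back has at most 3 choices at each step after the first, so a vertex
    of degree at most 3 reaches at most 1 + 3(1 + 3 + 9) = 40 vertices within distance 3. *)
Lemma within3_regular (T : finType) (e : rel T) :
  symmetric e -> within3 e -> (forall x, degree e x <= 4) -> 40 < #|T| ->
  forall x, degree e x = 4.
Proof.
move=> e_sym e3 deg4 T51 x.
pose N y := [set z | e y z].
have cN a b : e a b -> #|N b :\ a| <= 3.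
  by move=> ab; have := deg4 b; rewrite /degree (cardsD1 a) inE e_sym ab.
pose S2 := \bigcup_(a in N x) (N a :\ x).
pose S3 := \bigcup_(a in N x) \bigcup_(b in N a :\ x) (N b :\ a).
have cS2 : #|S2| <= #|N x| * 3.
  by apply: card_bigcup_leq => a; rewrite inE; apply: cN.
have cS3 : #|S3| <= #|N x| * 9.
  apply: card_bigcup_leq => a; rewrite inE => xa.
  apply: (@leq_trans (#|N a :\ x| * 3)); last by have := cN _ _ xa; lia.
  by apply: card_bigcup_leq => b; rewrite !inE => /andP[_]; apply: cN.
have cover : [set: T] \subset x |: (N x :|: S2 :|: S3).
  apply/subsetP=> y _; rewrite !inE; case: (eqVneq y x) => //= yx.
  case: (boolP (e x y)) => //= nxy; apply/orP.
  case: (e3 x y) => [xy|xy|[a xa ay]|[a [b [xa ab byE]]]].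
  - by rewrite xy eqxx in yx.
  - by rewrite xy in nxy.
  - by left; apply/bigcupP; exists a; rewrite !inE ?yx.
  - right; apply/bigcupP; exists a; rewrite ?inE //.
    have bx : b != x by apply: contraNneq nxy => <-.
    have ya : y != a by apply: contraNneq nxy => ->.
    by apply/bigcupP; exists b; rewrite !inE ?bx ?ya.
have := subset_leq_card cover; rewrite cardsT cardsU1 => cT.
have := (leq_card_setU (N x :|: S2) S3).1; have := (leq_card_setU (N x) S2).1.
have := deg4 x; rewrite /degree -/(N x).
have := leq_b1 (x \notin N x :|: S2 :|: S3); lia.
Qed.

(** * Orienting a 2-regular multigraph *)

(** The edges from [u] to [r u] and to [s u] form even cycles. The colour classes on such a cycle
    are two orbits of [s \o r], swapped by [r]; the colour records which of them has the smaller
    root. *)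
Lemma involutions_2colouring (D : finType) (r s : D -> D) :
  involutive r -> involutive s ->
  (forall u, r u != u) -> (forall u, s u != u) ->
  exists f : D -> bool, forall u, f (r u) = ~~ f u /\ f (s u) = ~~ f u.
Proof.
move=> rK sK rN sN; pose p := s \o r.
have p_inj : injective p := inj_comp (inv_inj sK) (inv_inj rK).
(* If [p^(k+2) u = r u], cancelling [s] and [r] gives [p^k (p u) = r (p u)]: the induction descends
   by two and needs both base cases. *)
have far k : forall u, (iter k p u != r u) /\ (iter k.+1 p u != r u).
  elim: k => [|k IH] u.
    by split; [rewrite eq_sym; apply: rN | apply: sN].
  split; first exact: (IH u).2.
  apply: contraNneq (IH (p u)).1 => E.
  have {}E : s (r (iter k p (p u))) = r u by rewrite -E iterSr.
  by apply/eqP; rewrite -[LHS]rK -[r (iter _ _ _)]sK E.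
have rfar u : froot p u != froot p (r u).
  apply/eqP=> /(fingraph.rootP (fconnect_sym p_inj)) /iter_findex E.
  by case/eqP: (far (findex p u (r u)) u).1.
have rootp u : froot p (p u) = froot p u.
  by apply/esym/(fingraph.rootP (fconnect_sym p_inj))/fconnect1.
exists (fun u => enum_rank (froot p u) < enum_rank (froot p (r u))) => u.
have E : (enum_rank (froot p (r u)) < enum_rank (froot p u)) =
    ~~ (enum_rank (froot p u) < enum_rank (froot p (r u))).
  have: (enum_rank (froot p u) != enum_rank (froot p (r u)) :> nat).
    by rewrite val_eqE (inj_eq enum_rank_inj).
  by rewrite -leqNgt [RHS]leq_eqVlt eq_sym => /negPf ->.
split; first by rewrite rK.
have -> : froot p (s u) = froot p (r u) by rewrite -(rootp (r u)) /p /= rK.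
by have -> : froot p (r (s u)) = froot p u by rewrite -(rootp (r _)) /p /= rK sK.
Qed.

Lemma sum2_pair (T : finType) (w : T -> nat) : \sum_y w y = 2 ->
  exists n : bool -> T, forall y, w y = (n true == y) + (n false == y).
Proof.
move=> w2.
have [x wx]: exists x, 0 < w x.
  apply/existsP; apply: contraT; rewrite negb_exists => /forallP w0.
  by move: w2; rewrite big1 // => y _; have := w0 y; lia.
pose w' y := w y - (x == y).
have wE y : w y = (x == y) + w' y.
  by rewrite /w'; case: eqP wx => [<-|] /=; lia.
have sx : \sum_y (x == y : nat) = 1.
  by rewrite (bigD1 x) //= eqxx big1 ?addn0 // => y; rewrite eq_sym => /negPf->.
have w1 : \sum_y w' y = 1.
  by move: w2; rewrite (eq_bigr _ (fun y _ => wE y)) big_split /= sx => -[].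
have [z wz]: exists z, 0 < w' z.
  apply/existsP; apply: contraT; rewrite negb_exists => /forallP w0.
  by move: w1; rewrite big1 // => y _; have := w0 y; lia.
exists (fun b => if b then x else z) => y; rewrite wE; congr (_ + _).
move: w1; rewrite (bigD1 z) //=; case: (eqVneq z y) => [<- /=|zy]; first by lia.
by rewrite (bigD1 y) 1?eq_sym //=; lia.
Qed.

(* An edge of the 2-regular multigraph [b] at [x] is a dart [(x, i)]. The two
   fixed-point-free involutions on darts "other dart at the same vertex" and
   "same edge, other end" admit a common 2-colouring, which is an orientation. *)
Lemma orient_2regular (T : finType) (b : T -> T -> nat) :
  (forall x y, b x y = b y x) -> (forall x, \sum_y b x y = 2) ->
  (forall x, b x x != 1) ->
  exists s : {perm T}, forall x y, b x y = (s x == y) + (s y == x).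
Proof.
move=> b_sym b2 bxx.
have [n nE] : exists n : T -> bool -> T,
    forall x y, b x y = (n x true == y) + (n x false == y).
  have := fin_all_exists (fun x => sum2_pair (b2 x)).
  by case=> n nE; exists n => x y; apply: nE.
have bn x i : 0 < b (n x i) x.
  by rewrite b_sym nE; case: i; rewrite eqxx ?addn1.
have bnn x y : n x true = n x false -> 0 < b x y -> b x y = 2.
  by move=> E; rewrite !nE E; case: eqP.
have b2n x y : b x y = 2 -> n x true = y /\ n x false = y.
  by rewrite nE; case: eqP; case: eqP.
pose s (u : T * bool) := (u.1, ~~ u.2).
(* At a double edge or a loop, [r] flips the index, which keeps it an involution without fixed
   points. Otherwise it picks the only dart at [y] that points back. *)
pose r (u : T * bool) := let y := n u.1 u.2 in
  (y, if n y true == n y false then ~~ u.2 else n y true == u.1).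
have nr u : n (r u).1 (r u).2 = u.1.
  case: u => x i /=; have := bn x i; set y := n x i.
  case: eqP => [E /(bnn _ _ E)/b2n[n1 n2]|_]; first by case: (~~ i).
  by rewrite nE; case: eqP => // _; case: eqP.
have rK : involutive r.
  move=> u; have := nr u; case: u => x i /=.
  have := bn x i; set y := n x i => by0.
  case: (eqVneq (n y true) (n y false)) => [E|nE2] nyE.
    have [n1 n2] := b2n _ _ (bnn _ _ E by0).
    have bxy : b x y = 2 by rewrite b_sym; apply: bnn.
    have [m1 m2] := b2n _ _ bxy.
    by rewrite /r /= -/y E eqxx nyE m1 m2 eqxx negbK.
  rewrite /r /= -/y (negPf nE2) nyE; case: eqP => [E|nxE].
    have := bnn x y E; rewrite b_sym => /(_ by0) /b2n[n1 n2].
    by rewrite n1 n2 eqxx in nE2.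
  by congr (_, _); rewrite {}/y in by0 nE2 nyE nxE *; case: i {by0 nE2 nyE} nxE
    => nxE; [rewrite eqxx | case: eqP].
have rN u : r u != u.
  apply/eqP; case: u => x i [nx]; rewrite nx.
  have := bn x i; rewrite nx => bx0.
  have /b2n[-> ->] : b x x = 2.
    by move: (bxx x) bx0; rewrite nE; case: (_ == x); case: (_ == x).
  by rewrite eqxx; case: i {nx bx0}.
have sN u : s u != u by case: u => x []; rewrite xpair_eqE andbF.
have sK : involutive s by case=> x i; rewrite /s /= negbK.
have [f f_rs] := involutions_2colouring rK sK rN sN.
pose c x := f (x, true).
have fc x i : f (x, i) = (i == c x).
  rewrite /c; case: i => //=; have := (f_rs (x, true)).2; rewrite /s /= => ->.
  by case: (f _).
have rc x i : (r (x, i)).2 = (i != c x) (+) ~~ c (n x i).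
  have := (f_rs (x, i)).1; rewrite [r _]surjective_pairing !fc /=.
  by set j := if _ then _ else _; case: j; case: (i == _); case: (c _).
have nc x i : n (n x i) ((i != c x) (+) ~~ c (n x i)) = x.
  by rewrite -rc; apply: (nr (x, i)).
(* [c x] is the index of the dart leaving [x], so [g] is the successor map and [h] the predecessor
   map. *)
pose g x := n x (c x); pose h x := n x (~~ c x).
have hK : cancel h g.
  move=> x; have := nc x (~~ c x); rewrite -/(h x) /g.
  by case: (c x); rewrite /= ?negbK.
have [h1 _ h1K] := injF_bij (can_inj hK).
have g_inj : injective g.
  by move=> x y; rewrite -(h1K x) -(h1K y) !hK => ->.
exists (perm g_inj) => x y; rewrite nE !permE.
have -> : (g y == x) = (h x == y) by rewrite -[h x == y](inj_eq g_inj) hK eq_sym.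
by rewrite /g /h; case: (c x) => //=; rewrite addnC.
Qed.

(** * The discrete wave equation *)

(** The mixed difference of [M] along [U] and [V] vanishes on unit squares, and these tile an [i] by
    [j] rectangle. *)
Lemma dalembert (P : Type) (U V : P -> P) (M : P -> nat) :
  (forall p, U (V p) = V (U p)) ->
  (forall p, M (U (V p)) + M p = M (U p) + M (V p)) ->
  forall i j p, M (iter i U (iter j V p)) + M p = M (iter i U p) + M (iter j V p).
Proof.
move=> UV wave.
have UiV i p : iter i U (V p) = V (iter i U p).
  by elim: i => //= i ->; rewrite UV.
have step i p : M (iter i U (V p)) + M p = M (iter i U p) + M (V p).
  elim: i => [|i IH] /=; first by rewrite addnC.
  by have := wave (iter i U p); rewrite UiV in IH *; lia.
move=> i; elim=> [|j IH] p //=.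
by have := step i (iter j V p); have := IH p; lia.
Qed.

(** * Cycle lengths of a permutation *)

Section CycleLengths.

Variables (T : finType) (s : {perm T}).

Lemma iter_perm_dvdn i x : (iter i s x == x) = (fingraph.order s x %| i).
Proof.
set k := fingraph.order s x.
have iterMk m : iter (m * k) s x = x.
  elim: m => // m IH; rewrite mulSn iterD IH; exact/iter_order/perm_inj.
have k0 : 0 < k by rewrite fingraph.order_gt0.
rewrite {1}(divn_eq i k) addnC iterD iterMk /dvdn.
apply/eqP/eqP => [E|->//].
by rewrite -(findex_iter (ltn_pmod i k0)) E findex0.
Qed.

(** The cycles counted by [N_d], each represented by its root. *)
Definition cycles_dvd d : {set T} :=
  [set r | froots s r & d %| fingraph.order s r].

Lemma sum_cycle_lengths : \sum_(r | froots s r) fingraph.order s r = #|T|.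
Proof.
have fsym := fconnect_sym (@perm_inj _ s).
rewrite -[RHS]sum1_card [RHS](partition_big (froot s) (froots s)) /=; last first.
  by move=> x _; apply: roots_root.
apply: eq_bigr => r /eqP rr; rewrite /fingraph.order -sum1_card.
apply: eq_bigl => x; rewrite -[LHS]/(fconnect s r x).
by rewrite -(root_connect fsym) rr eq_sym.
Qed.

(** A cycle length is the sum of the totients of its divisors; exchanging the two sums groups the
    terms by divisor. *)
Lemma sum_totient_cycles_dvd :
  \sum_(d < #|T|.+1) totient d * #|cycles_dvd d| = #|T|.
Proof.
rewrite -[RHS]sum_cycle_lengths.
have E (d : 'I_#|T|.+1) : totient d * #|cycles_dvd d| =
    \sum_(r | froots s r && (d %| fingraph.order s r)) totient d.
  by rewrite sum_nat_const mulnC; congr (_ * _); apply: eq_card => r; rewrite inE.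
rewrite (eq_bigr _ (fun d _ => E d)) (exchange_big_dep (froots s)) /=; last first.
  by move=> d r _ /andP[].
apply: eq_bigr => r rr; rewrite -[RHS]sum_totient_dvd.
have le : (fingraph.order s r).+1 <= #|T|.+1 by rewrite ltnS max_card.
rewrite (big_ord_widen_cond _ (fun d => d %| fingraph.order s r) totient le).
apply: eq_bigl => d; rewrite rr /=; case: (boolP (_ %| _)) => //= dr.
by rewrite ltnS dvdn_leq // fingraph.order_gt0.
Qed.

End CycleLengths.

(** * Adjacency transported along cycles *)

Section Transport.

Variables (T : finType) (e : rel T) (s : {perm T}).
Hypothesis e_sym : symmetric e.
Hypothesis wave : forall x y,
  e (s x) y + e ((s^-1)%g x) y = e x (s y) + e x ((s^-1)%g y).

(** Moving both ends forward ([U]) or in opposite directions ([V]) turns [wave] into the hypothesis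
    of [dalembert]. If adjacency failed both after [U^i] and after [V^t], that identity would equate
    a sum of at least 1 with 0. *)
Lemma transport x y : e x y ->
  (forall t, e (iter t s x) (iter t s y)) \/
  (forall t, e (iter t s x) (iter t (s^-1)%g y)).
Proof.
move=> xy.
pose U (p : T * T) := (s p.1, s p.2).
pose V (p : T * T) := (s p.1, (s^-1)%g p.2).
pose M (p : T * T) : nat := e p.1 p.2.
have iterU t p : iter t U p = (iter t s p.1, iter t s p.2).
  by elim: t => [|t /= ->] //; case: p.
have iterV t p : iter t V p = (iter t s p.1, iter t (s^-1)%g p.2).
  by elim: t => [|t /= ->] //; case: p.
have UV p : U (V p) = V (U p) by rewrite /U /V /= permKV permK.
have waveM p : M (U (V p)) + M p = M (U p) + M (V p).
  by rewrite /M /U /V /= permKV -wave permK.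
case: (boolP [exists t : 'I_#[s]%g, ~~ e (iter t s x) (iter t s y)]) => [|H].
  case/existsP=> i nU; right=> t; apply: contraT => nV.
  have := dalembert UV waveM i t (x, y).
  by rewrite /M iterU iterV iterU /= xy (negPf nU) (negPf nV) addn1.
left=> t; rewrite negb_exists in H.
have := forallP H (Ordinal (ltn_pmod t (order_gt0 s))) => /=.
by rewrite negbK -!permX expg_mod_order.
Qed.

(** With [n] the cycle length of [y], the powers [s^(n j)] fix [y], so [y] is adjacent to every
    [s^(n j) x]. If [q] did not divide [n], these would be distinct for [j < 5], giving [y] five
    neighbours. *)
Lemma prime_dvd_cycle_neighbour q x y :
  (forall z, degree e z <= 4) -> prime q -> 4 < q -> e x y ->
  q %| fingraph.order s x -> q %| fingraph.order s y.
Proof.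
move=> deg4 q_pr q4 xy qx; apply: contraT => qy.
set n := fingraph.order s y in qy.
have sn j : iter (n * j) s y = y.
  by apply/eqP; rewrite iter_perm_dvdn dvdn_mulr.
have near j : e y (iter (n * j) s x).
  rewrite e_sym; case: (transport xy) => /(_ (n * j)); first by rewrite sn.
  rewrite -{1}(sn j); suff -> : iter (n * j) (s^-1)%g (iter (n * j) s y) = y by [].
  by elim: (n * j) => // k IH; rewrite iterSr [X in _ X]/= permK.
have inj : injective (fun j : 'I_5 => iter (n * j) s x).
  have half (i j : 'I_5) : i <= j -> iter (n * i) s x = iter (n * j) s x -> i = j.
    move=> ij; rewrite -{1}(subnKC ij) mulnDr iterD.
    rewrite -!permX => /perm_inj /esym/eqP; rewrite permX iter_perm_dvdn.
    move/(dvdn_trans qx); rewrite Euclid_dvdM // (negPf qy) /= => qij.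
    have := dvdn_leq _ qij; have := ltn_ord j => ? h.
    by apply/val_inj => /=; move: h; lia.
  move=> i j ij; case/orP: (leq_total i j) => l; first exact: half.
  by apply/esym/half.
have := deg4 y; rewrite /degree leqNgt => /negP[].
rewrite -[X in X < _]/4 -[5]card_ord -(card_imset _ inj).
by apply/subset_leq_card/subsetP => _ /imsetP[j _ ->]; rewrite inE.
Qed.

Lemma prime_dvd_cycles q x :
  (forall z, degree e z <= 4) -> within3 e -> prime q -> 4 < q ->
  q %| fingraph.order s x -> q %| #|T|.
Proof.
move=> deg4 e3 q_pr q4 qx; rewrite -(sum_cycle_lengths s).
apply: dvdn_sum => y _.
have nb := prime_dvd_cycle_neighbour deg4 q_pr q4.
case: (e3 x y) => [<-//|xy|[a xa ay]|[a [b [xa ab byE]]]].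
- exact: nb xy qx.
- exact: nb ay (nb _ _ xa qx).
- exact: nb byE (nb _ _ ab (nb _ _ xa qx)).
Qed.

End Transport.

Local Open Scope ring_scope.

(** * Stable subspaces annihilated by an irreducible polynomial *)

Section StableRank.

Variables (F : fieldType) (n d : nat) (A : 'M[F]_n.+1) (f : {poly F}).
Hypotheses (f_irr : irreducible_poly f) (size_f : size f = d.+1).

Definition krylov (v : 'rV[F]_n.+1) : 'M[F]_(d, n.+1) :=
  \matrix_(i < d) (v *m A ^+ i).

Lemma mul_krylov a v : a *m krylov v = v *m horner_mx A (rVpoly a).
Proof.
have -> : rVpoly a = \sum_(i < d) a 0 i *: 'X^i.
  by rewrite /rVpoly poly_def; apply: eq_bigr => i _; rewrite valK.
rewrite mulmx_sum_row rmorph_sum mulmx_sumr; apply: eq_bigr => i _ /=.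
by rewrite rowK linearZ /= rmorphXn /= horner_mx_X scalemxAr.
Qed.

Lemma horner_mx_sub_krylov v (h : {poly F}) :
  v *m horner_mx A f = 0 -> (v *m horner_mx A h <= krylov v)%MS.
Proof.
move=> vf0; have f0 : f != 0 by rewrite -size_poly_eq0 size_f.
have sz : (size (h %% f)%R <= d)%N by rewrite -ltnS -size_f ltn_modp.
have -> : v *m horner_mx A h = v *m horner_mx A (h %% f).
  rewrite {1}(divp_eq h f) mulrC rmorphD rmorphM /= mulmxDr.
  by rewrite -[_ * _]/(_ *m _) mulmxA vf0 mul0mx add0r.
by rewrite -[h %% f](poly_rV_K sz) -mul_krylov submxMl.
Qed.

(* [U] is a vector space over the field [F[X] / f], which has degree [d]. *)
Lemma stablemx_irreducible_rank (U : 'M[F]_n.+1) :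
  stablemx U A -> U *m horner_mx A f = 0 -> (d %| \rank U)%N.
Proof.
move=> UA Uf0.
have d0 : (0 < d)%N by rewrite -ltnS -size_f; case: f_irr.
(* [W] grows inside [U] by Krylov spaces of dimension [d]; requiring a rank above that of [U] forces
   it to exhaust [U]. *)
suff /(_ (\rank U).+1)[W [WU WA dW /orP[lt|UW]]] : forall k, exists W : 'M[F]_n.+1,
    [/\ (W <= U)%MS, stablemx W A, (d %| \rank W)%N & (k <= \rank W)%N || (U <= W)%MS].
- by have := mxrankS WU; rewrite leqNgt lt.
- suff -> : \rank U = \rank W by [].
  by apply/eqP; rewrite eqn_leq !mxrankS.
elim=> [|k [W [WU WA dW]]].
  by exists 0; rewrite sub0mx mul0mx sub0mx mxrank0 dvdn0.
case UW : (U <= W)%MS; first by exists W; rewrite UW orbT.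
rewrite orbF => leWk.
have /row_subPn[i vW] : ~~ (U <= W)%MS by rewrite UW.
set v := row i U in vW.
have vf0 : v *m horner_mx A f = 0 by rewrite -row_mul Uf0 row0.
have WhA (X : 'rV_n.+1) h : (X <= W)%MS -> (X *m horner_mx A h <= W)%MS.
  by move=> XW; apply: submx_trans (submxMr _ XW) _; apply: horner_mx_stable.
(* A nonzero polynomial of degree below [d] is coprime to [f]; if it sent [v] into [W], a Bezout
   relation would put [v] itself in [W]. *)
have cap0 (a : 'rV_d) : (a *m krylov v <= W)%MS -> a = 0.
  rewrite mul_krylov => vhW; apply/eqP; apply: contraT => a0.
  have h0 : rVpoly a != 0 by apply: contraNneq a0 => h0; rewrite -(rVpolyK a) h0 linear0.
  have /Bezout_eq1_coprimepP[[u w] /= uw1] : coprimep f (rVpoly a).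
    rewrite irreducible_poly_coprime //; apply/negP => /(dvdp_leq h0).
    by rewrite size_f ltnNge size_poly.
  case/negP: vW.
  have -> : v = v *m horner_mx A 1 by rewrite rmorph1 [RHS]mulmx1.
  rewrite -uw1 rmorphD mulmxDr.
  rewrite [u * f]mulrC [w * _]mulrC !rmorphM /= -![_ * _]/(_ *m _) !mulmxA vf0.
  by rewrite mul0mx add0r WhA.
have free : row_free (krylov v).
  by apply: inj_row_free => a a0; apply: cap0; rewrite a0 sub0mx.
have dis : (W :&: krylov v)%MS = 0.
  apply/eqP/rowV0P => x; rewrite sub_capmx => /andP[xW /submxP[a xa]].
  by rewrite xa (cap0 a) ?mul0mx // -xa.
have kU : (krylov v <= U)%MS.
  apply/row_subP => j; rewrite rowK -(horner_mx_X A) -rmorphXn /=.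
  by apply: submx_trans (submxMr _ (row_sub i U)) _; apply: horner_mx_stable.
have rk : \rank (W + krylov v)%MS = (\rank W + d)%N.
  by rewrite mxrank_disjoint_sum // (eqP free).
exists (W + krylov v)%MS; split.
- by rewrite addsmx_sub WU.
- rewrite addsmxMr; apply: addsmxS => //.
  apply/row_subP => j; rewrite row_mul rowK -mulmxA -[A ^+ j *m A]exprSr.
  by rewrite -(horner_mx_X A) -rmorphXn horner_mx_sub_krylov.
- by rewrite rk dvdn_addl.
- by rewrite rk -addn1 leq_add.
Qed.

End StableRank.

(** * Eigenspaces of a permutation matrix and of its sum with its inverse *)

Section PermEigenspace.

Variables (F : fieldType) (n : nat) (s : {perm 'I_n}) (a : F).

Lemma mul_perm_mxV m (v : 'M[F]_(m, n)) i x : (v *m perm_mx s^-1) i x = v i (s x).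
Proof. by rewrite -col_permE mxE. Qed.

Lemma expr_findex r j : a ^+ fingraph.order s r = 1 ->
  a ^+ findex s r (iter j s r) = a ^+ j.
Proof.
set k := fingraph.order s r => ak.
have k0 : (0 < k)%N by rewrite fingraph.order_gt0.
have -> : iter j s r = iter (j %% k) s r.
  rewrite {1}(divn_eq j k) addnC iterD; congr iter.
  by apply/eqP; rewrite iter_perm_dvdn dvdn_mull.
rewrite findex_iter ?ltn_pmod // [in RHS](divn_eq j k).
by rewrite exprD mulnC exprM ak expr1n mul1r.
Qed.

Variable d : nat.
Hypothesis a_d : forall k, (0 < k <= n)%N -> (a ^+ k == 1) = (d %| k)%N.

Let a_order r : (a ^+ fingraph.order s r == 1) = (d %| fingraph.order s r)%N.
Proof. by rewrite a_d // fingraph.order_gt0 -[X in (_ <= X)%N]card_ord max_card. Qed.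

(** An eigenvector satisfies [v (s x) = a v x], so its value at the root determines it on a cycle;
    this value can be nonzero exactly when [a] to the cycle length is 1. The rows of [K] are the
    resulting basis. *)
Lemma rank_eigenspace_perm :
  \rank (eigenspace (perm_mx s^-1) a) = #|cycles_dvd s d|.
Proof.
have fsym := fconnect_sym (@perm_inj _ s).
pose rt (i : 'I_#|cycles_dvd s d|) := enum_val i.
have rtP i : froot s (rt i) = rt i /\ a ^+ fingraph.order s (rt i) = 1.
  have := enum_valP i; rewrite inE => /andP[/eqP r0 dr].
  by split=> //; apply/eqP; rewrite a_order.
pose K : 'M[F]_(#|cycles_dvd s d|, n) :=
  \matrix_(i, x) (if froot s x == rt i then a ^+ findex s (rt i) x else 0).
have rootS x : froot s (s x) = froot s x.
  by apply/esym/(fingraph.rootP fsym)/fconnect1.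
have iterroot x : iter (findex s (froot s x) x) s (froot s x) = x.
  by apply: iter_findex; rewrite fsym connect_root.
have KE : (K <= eigenspace (perm_mx s^-1) a)%MS.
  apply/eigenspaceP/matrixP => i x; rewrite mul_perm_mxV !mxE rootS.
  case: eqP => [E|_]; last by rewrite mulr0.
  have [_ ai] := rtP i.
  by rewrite -{1}(iterroot x) E -iterS expr_findex // exprS.
have EK : (eigenspace (perm_mx s^-1) a <= K)%MS.
  apply/rV_subP => v /eigenspaceP vP.
  have vS x : v 0 (s x) = a * v 0 x by rewrite -mul_perm_mxV vP mxE.
  have viter j x : v 0 (iter j s x) = a ^+ j * v 0 x.
    by elim: j => [|j IH]; rewrite ?mul1r //= vS IH exprS mulrA.
  suff -> : v = (\row_i v 0 (rt i)) *m K by apply: submxMl.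
  apply/rowP => x; rewrite mxE; set r := froot s x.
  have vx : v 0 x = a ^+ findex s r x * v 0 r by rewrite -viter iterroot.
  have rr : froots s r by apply: roots_root.
  case: (boolP (r \in cycles_dvd s d)) => rC.
    rewrite (bigD1 (enum_rank_in rC r)) //= !mxE /rt enum_rankK_in // eqxx.
    rewrite big1 ?addr0 => [|i ir]; first by rewrite mulrC.
    rewrite !mxE -/r; case: eqP => [E|_]; last by rewrite mulr0.
    by rewrite -(enum_valK_in rC i) -/(rt i) -E eqxx in ir.
  rewrite big1 => [|i _]; last first.
    rewrite !mxE -/r; case: eqP => [E|_]; last by rewrite mulr0.
    by rewrite E enum_valP in rC.
  rewrite vx; suff -> : v 0 r = 0 by rewrite mulr0.
  have := viter (fingraph.order s r) r; rewrite iter_order; last exact: perm_inj.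
  move/eqP; rewrite -{1}[v 0 r]mul1r -subr_eq0 -mulrBl mulf_eq0 subr_eq0 eq_sym.
  by rewrite a_order; move: rC; rewrite inE rr /= => /negPf -> /= /eqP.
have -> : \rank (eigenspace (perm_mx s^-1) a) = \rank K.
  by apply/eqP; rewrite eqn_leq !mxrankS.
(* The columns of [K] at the roots form an identity matrix. *)
apply/eqP/row_freeP; exists (\matrix_(x, j) (x == rt j)%:R).
apply/matrixP => i j; rewrite !mxE (bigD1 (rt j)) //= !mxE eqxx mulr1.
rewrite big1 ?addr0 => [|x /negPf xj]; last by rewrite !mxE xj mulr0.
rewrite (rtP j).1 (inj_eq enum_val_inj) eq_sym.
by case: eqP => // ->; rewrite findex0.
Qed.

Definition cycle_mx : 'M[F]_n := perm_mx s + perm_mx s^-1.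

Lemma perm_mxVK m (v : 'M[F]_(m, n)) : v *m perm_mx s^-1 *m perm_mx s = v.
Proof. by rewrite -mulmxA -perm_mxM mulVg perm_mx1 mulmx1. Qed.

Lemma perm_mxKV m (v : 'M[F]_(m, n)) : v *m perm_mx s *m perm_mx s^-1 = v.
Proof. by rewrite -mulmxA -perm_mxM mulgV perm_mx1 mulmx1. Qed.

(** Multiplying the eigenvalue equation by [perm_mx s^-1] gives a recurrence along cycles with
    characteristic polynomial [X^2 - mu X + 1], whose roots are [a] and [b] if [mu = a + b] and
    [a b = 1]. *)
Lemma eigenspace_cycle_mxP m (V : 'M[F]_(m, n)) mu :
  (V <= eigenspace cycle_mx mu)%MS ->
  V *m perm_mx s^-1 *m perm_mx s^-1 = mu *: (V *m perm_mx s^-1) - V.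
Proof.
move/eigenspaceP => E; rewrite scalemxAl -E mulmxDr mulmxDl perm_mxKV.
by rewrite [X in _ = X - V]addrC addrK.
Qed.

Lemma sub_eigenspace_cycle_mx b : a * b = 1 ->
  (eigenspace (perm_mx s^-1) a <= eigenspace cycle_mx (a + b))%MS.
Proof.
move=> ab; apply/eigenspaceP; set W := eigenspace _ a.
have WP : W *m perm_mx s^-1 = a *: W by apply/eigenspaceP.
have WV : W *m perm_mx s = b *: W.
  by rewrite -{2}(perm_mxVK W) WP -scalemxAl scalerA mulrC ab scale1r.
by rewrite mulmxDr WV WP -scalerDl addrC.
Qed.

End PermEigenspace.

Section CycleEigenspace.

Variables (F : fieldType) (n : nat) (s : {perm 'I_n}) (a b : F) (d : nat).
Hypothesis a_d : forall k, (0 < k <= n)%N -> (a ^+ k == 1) = (d %| k)%N.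
Hypothesis ab : a * b = 1.

(** For distinct roots the eigenspace is the direct sum of those of [perm_mx s^-1] for [a] and [b],
    and both roots have the same order [d]. *)
Lemma rank_eigenspace_cycle_mx : a != b ->
  \rank (eigenspace (cycle_mx F s) (a + b)) = #|cycles_dvd s d|.*2.
Proof.
move=> anb.
have b_d k : (0 < k <= n)%N -> (b ^+ k == 1) = (d %| k)%N.
  move=> kn; rewrite -a_d //.
  have: a ^+ k * b ^+ k = 1 by rewrite -exprMn ab expr1n.
  by move=> abk; apply/eqP/eqP => E; move: abk; rewrite E ?mulr1 ?mul1r.
have ba : b * a = 1 by rewrite mulrC.
pose P : 'M[F]_n := perm_mx s^-1.
have split_sum : \rank (eigenspace (cycle_mx F s) (a + b)) =
    \rank (eigenspace P a + eigenspace P b)%MS.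
  apply/eqP; rewrite eqn_leq; apply/andP; split; apply: mxrankS; last first.
    rewrite addsmx_sub; apply/andP; split; first exact: sub_eigenspace_cycle_mx.
    by rewrite [a + b]addrC; apply: sub_eigenspace_cycle_mx.
  set V := eigenspace _ _.
  have VP := eigenspace_cycle_mxP (submx_refl V); rewrite -/P in VP.
  have half x y : x * y = 1 -> a + b = x + y -> (V *m P - y *: V <= eigenspace P x)%MS.
    move=> xy E; apply/eigenspaceP.
    rewrite mulmxBl -scalemxAl VP E scalerDl scalerBr scalerA xy scale1r.
    by rewrite addrAC addrK.
  (* [V P - b V] and [V P - a V] lie in the eigenspaces for [a] and [b], and their difference is
     [(a - b) V]. *)
  have -> : V = (a - b)^-1 *: (V *m P - b *: V) - (a - b)^-1 *: (V *m P - a *: V).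
    rewrite -scalerBr opprB [X in _ *: X]addrC addrA subrK -scalerBl scalerA mulVf.
      by rewrite scale1r.
    by rewrite subr_eq0.
  apply: addmx_sub; first by apply/scalemx_sub/submx_trans/addsmxSl/half.
  by rewrite eqmx_opp; apply/scalemx_sub/submx_trans/addsmxSr/half; rewrite // addrC.
rewrite split_sum mxrank_disjoint_sum.
  by rewrite !(rank_eigenspace_perm s (d := d)) // addnn.
apply/eqP/rowV0P => v; rewrite sub_capmx => /andP[/eigenspaceP va /eigenspaceP vb].
move: va; rewrite vb => /eqP; rewrite -subr_eq0 -scalerBl scaler_eq0 subr_eq0.
by rewrite eq_sym (negPf anb) => /eqP.
Qed.

Hypothesis n_F : forall k, (0 < k <= n)%N -> k%:R != 0 :> F.

(* Off the eigenspace of the permutation, an element would grow linearly along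
   a cycle. *)
Lemma rank_eigenspace_cycle_mx1 : a = b ->
  \rank (eigenspace (cycle_mx F s) (a + b)) = #|cycles_dvd s d|.
Proof.
move=> Eab; rewrite -(rank_eigenspace_perm s (a_d)).
apply/eqP; rewrite eqn_leq; apply/andP; split; apply: mxrankS; last first.
  exact: sub_eigenspace_cycle_mx.
apply/rV_subP => v vE; apply/eigenspaceP.
have := eigenspace_cycle_mxP vE; rewrite -Eab => vPP.
have aa : a * a = 1 by rewrite {2}Eab.
pose w := v *m perm_mx s^-1 - a *: v.
have wE x : w 0 x = v 0 (s x) - a * v 0 x by rewrite mxE mul_perm_mxV !mxE.
have vS x : v 0 (s x) = a * v 0 x + w 0 x by rewrite wE addrC subrK.
have vSS x : v 0 (s (s x)) = (a + a) * v 0 (s x) - v 0 x.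
  have /rowP/(_ x) := vPP; rewrite !mul_perm_mxV => ->.
  by rewrite mxE [X in X + _]mxE mul_perm_mxV mxE.
have wS x : w 0 (s x) = a * w 0 x by rewrite !wE vSS; ring: aa.
have wit k x : w 0 (iter k s x) = a ^+ k * w 0 x.
  by elim: k => [|k IH]; rewrite ?mul1r //= wS IH exprS mulrA.
(* The factor [a] on the left avoids the exponent [k - 1], which would be truncated at [k = 0]. *)
have vit k x : a * v 0 (iter k s x) = a ^+ k * (a * v 0 x + k%:R * w 0 x).
  elim: k => [|k IH]; first by rewrite mul0r addr0 mul1r.
  by rewrite /= vS wit mulrDr IH exprS -natr1; ring.
suff w0 : w = 0 by apply/eqP; rewrite -subr_eq0 -/w w0.
apply/rowP => x; rewrite [RHS]mxE.
set k := fingraph.order s x.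
have kn : (0 < k <= n)%N.
  by rewrite fingraph.order_gt0 -[X in (_ <= X)%N]card_ord max_card.
have itk : iter k s x = x by apply/iter_order/perm_inj.
apply/eqP; apply: contraT => wx.
have ak : a ^+ k = 1.
  by apply: (mulIf wx); rewrite mul1r -wit itk.
have /eqP := vit k x; rewrite itk ak mul1r -subr_eq0 opprD addNKr oppr_eq0.
by rewrite mulf_eq0 (negPf wx) (negPf (n_F kn)).
Qed.

End CycleEigenspace.

(** * The cubic satisfied by the adjacency matrix on an eigenspace *)

Section Cubic.

Variables (F : fieldType) (c : F).

Definition defect_cubic : {poly F} := 'X^3 + 'X^2 - 6%:R *: 'X - (3%:R + c)%:P.

Lemma defect_cubicE : defect_cubic = (('X + 1) * 'X + (- 6%:R)%:P) * 'X + (- 3%:R - c)%:P.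
Proof.
rewrite /defect_cubic -mul_polyC !polyCD !polyCN; ring.
Qed.

Lemma size_defect_cubic : size defect_cubic = 4%N.
Proof.
have Xa1 : size ('X + 1 : {poly F}) = 2%N by rewrite size_XaddC.
have nz : ('X + 1 : {poly F}) != 0 by rewrite -size_poly_eq0 Xa1.
have s3 : size (('X + 1) * 'X + (- 6%:R)%:P : {poly F}) = 3%N.
  by rewrite size_MXaddC (negPf nz) Xa1.
by rewrite defect_cubicE size_MXaddC -size_poly_eq0 s3.
Qed.

Hypothesis no_root : forall x : F, x ^+ 3 + x ^+ 2 - 6%:R * x - 3%:R != c.

Lemma defect_cubic_irreducible : irreducible_poly defect_cubic.
Proof.
apply: cubic_irreducible; first by rewrite size_defect_cubic.
move=> x; apply: contra (no_root x); rewrite /root /defect_cubic !hornerE.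
by rewrite subr_eq0 => /eqP E; rewrite E; apply/eqP; ring.
Qed.

Lemma horner_mx_defect_cubic n (A : 'M[F]_n.+1) :
  horner_mx A defect_cubic = A ^+ 3 + A ^+ 2 - 6%:R *: A - (3%:R + c)%:M.
Proof.
by rewrite 2!rmorphB rmorphD !rmorphXn /= horner_mxZ horner_mx_X horner_mx_C.
Qed.

End Cubic.

(** * Cycle counts modulo 3 *)

Section CycleCount.

Variables (F : fieldType) (n : nat) (s : {perm 'I_n.+1}) (A : 'M[F]_n.+1).
Let J : 'M[F]_n.+1 := const_mx 1.
Hypothesis AJ : A *m J = J *m A.
Hypothesis A1 : A *m const_mx 1 = 4%:R *: const_mx 1 :> 'cV_n.+1.
Hypothesis eqA : A ^+ 3 + A ^+ 2 - 6%:R *: A - 3%:R%:M = J + cycle_mx F s.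
Hypothesis n_F : forall k, (0 < k <= n.+1)%N -> k%:R != 0 :> F.

Variables (a b : F) (d : nat).
Hypothesis a_d : forall k, (0 < k <= n.+1)%N -> (a ^+ k == 1) = (d %| k)%N.
Hypothesis ab : a * b = 1.
Hypothesis no_root : forall x : F, x ^+ 3 + x ^+ 2 - 6%:R * x - 3%:R != a + b.

Lemma cycle_mx_const : cycle_mx F s *m const_mx 1 = 2%:R *: const_mx 1 :> 'cV_n.+1.
Proof.
rewrite mulmxDl -!row_permE !row_perm_const.
by rewrite -[X in X + X]scale1r -scalerDl.
Qed.

Lemma const_cycle_mx : const_mx 1 *m cycle_mx F s = 2%:R *: const_mx 1 :> 'rV_n.+1.
Proof.
rewrite mulmxDr -col_permE -{1}[s]invgK -col_permE !col_perm_const.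
by rewrite -[X in X + X]scale1r -scalerDl.
Qed.

Lemma comm_adj_cycle_mx : A *m cycle_mx F s = cycle_mx F s *m A.
Proof.
have -> : cycle_mx F s = A ^+ 3 + A ^+ 2 - 6%:R *: A - 3%:R%:M - J.
  by rewrite eqA addrC addrA addNr add0r.
rewrite !(mulmxBl, mulmxBr) AJ; congr (_ - _).
rewrite !(mulmxDl, mulmxDr) scalar_mxC -scalemxAl -scalemxAr.
by rewrite -![_ *m _]/(_ * _) -!exprS -!exprSr.
Qed.

Let one : 'cV[F]_n.+1 := const_mx 1.
Let E := eigenspace (cycle_mx F s) (a + b).

(** On the sum-zero part of [E], [J] acts as 0 and [cycle_mx] as [a + b], so [defect_cubic (a + b)]
    evaluated at [A] vanishes there. Stability holds because [A] commutes with [cycle_mx] and has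
    constant row sums. *)
Lemma three_dvd_rank : (3 %| \rank (E :&: kermx one)%MS)%N.
Proof.
set U := (_ :&: _)%MS.
have UE : (U <= E)%MS by apply: capmxSl.
have UB : U *m cycle_mx F s = (a + b) *: U by apply/eigenspaceP.
have U1 : U *m const_mx 1 = 0 :> 'cV_n.+1 by apply/sub_kermxP/capmxSr.
apply: (stablemx_irreducible_rank (f := defect_cubic (a + b)) (A := A)).
- exact: defect_cubic_irreducible.
- exact: size_defect_cubic.
- rewrite sub_capmx; apply/andP; split.
    apply/eigenspaceP; rewrite -mulmxA comm_adj_cycle_mx mulmxA UB.
    by rewrite scalemxAl.
  by apply/sub_kermxP; rewrite -mulmxA A1 -scalemxAr U1 scaler0.
rewrite horner_mx_defect_cubic [X in _ *m (_ - X)]raddfD opprD addrA eqA.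
rewrite mulmxBr mulmxDr UB.
have -> : U *m J = 0.
  have -> : J = (const_mx 1 : 'cV_n.+1) *m (const_mx 1 : 'rV_n.+1).
    by apply/matrixP => i j; rewrite !mxE big_ord1 !mxE mulr1.
  by rewrite mulmxA U1 mul0mx.
by rewrite add0r mul_mx_scalar subrr.
Qed.

(** The coordinate sum of a vector of [E] is multiplied both by [a + b] and by 2, and
    [a + b - 2 = b (a - 1)^2]; so it vanishes unless [a = 1]. In that case [E] contains the all-ones
    vector, whose sum [n + 1] is nonzero in [F]. *)
Lemma rank_eigenspace_sum0 :
  (\rank (E :&: kermx one)%MS + (a == 1%R) = \rank E)%N.
Proof.
rewrite -(mxrank_mul_ker E one) addnC; congr (_ + _)%N.
have EB : E *m cycle_mx F s = (a + b) *: E by apply/eigenspaceP.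
have EB1 : E *m cycle_mx F s *m one = (a + b) *: (E *m one) by rewrite EB scalemxAl.
have EB2 : E *m cycle_mx F s *m one = 2%:R *: (E *m one).
  by rewrite -mulmxA cycle_mx_const scalemxAr.
have : (a + b - 2%:R) *: (E *m one) = 0 by rewrite scalerBl -EB1 EB2 subrr.
move/eqP; rewrite scaler_eq0.
have -> : (a + b - 2%:R == 0) = (a == 1).
  have -> : a + b - 2%:R = b * (a - 1) ^+ 2.
    by ring: ab.
  rewrite mulf_eq0 expf_eq0 subr_eq0 /=.
  by case: eqP ab => // ->; rewrite mulr0 => /esym/eqP; rewrite oner_eq0.
case: eqP => [a1 _|_ /eqP->]; last by rewrite mxrank0.
have b1 : b = 1 by rewrite -ab a1 mul1r.
apply/esym/eqP; rewrite eqn_leq rank_leq_col lt0n mxrank_eq0 /=.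
apply/eqP => E0.
have /submxP[x xE] : ((const_mx 1%R : 'rV[F]_n.+1) <= E)%MS.
  by apply/eigenspaceP; rewrite const_cycle_mx a1 b1.
have := congr1 (mulmx x) E0; rewrite mulmx0 mulmxA -xE => /matrixP/(_ 0 0)/eqP.
rewrite !mxE (eq_bigr (fun=> 1)) => [|i _]; last by rewrite !mxE mulr1.
by rewrite sumr_const card_ord (negPf (n_F _)) ?leqnn.
Qed.

(** The rank of [E] is [N_d] if [a = b] and [2 N_d] otherwise; the factor 2 is coprime to 3. *)
Lemma three_dvd_cycles_dvd :
  (3 %| #|cycles_dvd s d| - (d == 1%N))%N.
Proof.
have a1 : (a == 1) = (d == 1%N) by rewrite -[a]expr1 a_d // dvdn1.
have := three_dvd_rank; have := rank_eigenspace_sum0; rewrite -{}a1.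
case: (eqVneq a b) => [Eab|anb].
  rewrite (rank_eigenspace_cycle_mx1 s a_d ab n_F Eab) => <-.
  by rewrite addnK.
rewrite (rank_eigenspace_cycle_mx s a_d ab anb).
have -> : (a == 1) = false.
  by apply: contraNF anb => /eqP a1; move: ab; rewrite a1 mul1r => ->.
by rewrite addn0 => ->; rewrite subn0 -muln2 Gauss_dvdl.
Qed.

End CycleCount.

Local Close Scope ring_scope.

(** * The matrix [B] in terms of walk counts *)

Section DefectMatrix.

Variables (T : finType) (e : rel T).
Hypotheses (e_sym : symmetric e) (e_irr : irreflexive e) (e3 : within3 e).
Hypothesis deg4 : forall x, degree e x = 4.

Definition walks2 x y : nat := \sum_z e x z * e z y.
Definition walks3 x y : nat := \sum_z e x z * walks2 z y.
(** The entries of [B]; by [defectE] the subtraction never truncates. *)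
Definition defect x y : nat :=
  walks3 x y + walks2 x y - (6 * e x y + 3 * (x == y) + 1).

Lemma sum_adj x : \sum_y e x y = 4.
Proof.
rewrite -(deg4 x) /degree -sum1dep_card [RHS]big_mkcond.
by apply: eq_bigr => y _; case: (e x y).
Qed.

Lemma walks2_gt0 x z y : e x z -> e z y -> 0 < walks2 x y.
Proof. by move=> xz zy; rewrite /walks2 (bigD1 z) //= xz zy. Qed.

Lemma walks2_diag x : walks2 x x = 4.
Proof.
rewrite -(sum_adj x); apply: eq_bigr => z _.
by rewrite [e z x]e_sym mulnn; case: (e x z).
Qed.

(** There are four walks [x y t y], and three walks [x z x y] with [z] different from [y]. *)
Lemma walks3_adj x y : e x y -> 7 <= walks3 x y.
Proof.
move=> xy; rewrite /walks3 (bigD1 y) //= xy walks2_diag.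
have := sum_adj x; rewrite (bigD1 y) //= xy => -[S3].
rewrite mul1n -[7]/(4 + 3) leq_add2l -S3; apply: leq_sum => z _.
by case: (boolP (e x z)) => // xz; rewrite mul1n (walks2_gt0 _ xy) // e_sym.
Qed.

(** The amount subtracted is 4 on the diagonal, where there are four closed 2-walks; 7 at an edge,
    covered by [walks3_adj]; and 1 elsewhere, where [within3] supplies a walk of length 2 or 3. *)
Lemma defectE x y :
  walks3 x y + walks2 x y = defect x y + (6 * e x y + 3 * (x == y) + 1).
Proof.
rewrite /defect subnK //.
case: (eqVneq x y) => [<-|xy]; first by rewrite e_irr walks2_diag leq_addl.
case: (boolP (e x y)) => [/walks3_adj|nxy]; first by lia.
case: (e3 x y) => [E|E|[z xz zy]|[z [t [xz zt ty]]]].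
- by rewrite E eqxx in xy.
- by rewrite E in nxy.
- by have := walks2_gt0 xz zy; lia.
- rewrite /walks3 (bigD1 z) //= xz.
  by have := walks2_gt0 zt ty; lia.
Qed.

Lemma sum_walks2 x : \sum_y walks2 x y = 16.
Proof.
rewrite exchange_big (eq_bigr (fun z => e x z * 4)) => [|z _] /=.
  by rewrite -big_distrl /= sum_adj.
by rewrite -big_distrr sum_adj.
Qed.

Lemma sum_walks3 x : \sum_y walks3 x y = 64.
Proof.
rewrite exchange_big (eq_bigr (fun z => e x z * 16)) => [|z _] /=.
  by rewrite -big_distrl /= sum_adj.
by rewrite -big_distrr sum_walks2.
Qed.

(** The row sum is 64 + 16 - 24 - 3 - 51. *)
Lemma sum_defect x : #|T| = 51 -> \sum_y defect x y = 2.
Proof.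
move=> T51.
have : \sum_y (walks3 x y + walks2 x y) =
    \sum_y (defect x y + (6 * e x y + 3 * (x == y) + 1)).
  by apply: eq_bigr => y _; apply: defectE.
have diag : \sum_y (x == y : nat) = 1.
  by rewrite (bigD1 x) //= eqxx big1 ?addn0 // => y; rewrite eq_sym => /negPf->.
have s6 : \sum_y 6 * e x y = 24 by rewrite -big_distrr sum_adj.
have s3 : \sum_y 3 * (x == y) = 3 by rewrite -big_distrr /= diag.
rewrite 4!big_split /= s6 s3 sum_walks3 sum_walks2 sum1_card T51.
by lia.
Qed.

Lemma walks2_sym x y : walks2 x y = walks2 y x.
Proof. by apply: eq_bigr => z _; rewrite mulnC [e z x]e_sym [e z y]e_sym. Qed.

Lemma walks3_sym x y : walks3 x y = walks3 y x.
Proof.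
rewrite /walks3 /walks2.
under eq_bigr do rewrite big_distrr.
under [RHS]eq_bigr do rewrite big_distrr.
rewrite exchange_big /=; apply: eq_bigr => z _; apply: eq_bigr => t _.
by rewrite mulnCA mulnA mulnC [e z y]e_sym [e t z]e_sym [e x t]e_sym; lia.
Qed.

Lemma defect_sym x y : defect x y = defect y x.
Proof. by rewrite /defect walks3_sym walks2_sym e_sym eq_sym. Qed.

(* A triangle through [x] yields two closed walks, one for each direction. *)
Lemma defect_diag x : defect x x != 1.
Proof.
have := defectE x x; rewrite walks2_diag e_irr eqxx => E.
apply/eqP => d1; have {E d1} w1 : walks3 x x = 1 by lia.
have [y] : exists y, 0 < e x y * walks2 y x.
  apply/existsP; apply: contraPT w1; rewrite negb_exists => /forallP w0.
  by rewrite /walks3 big1 // => y _; have := w0 y; lia.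
rewrite muln_gt0 lt0b => /andP[xy].
case: (boolP [exists z, e y z && e z x]) => [/existsP[z /andP[yz zx]] _|]; last first.
  rewrite negb_exists => /forallP w0; rewrite /walks2 big1 // => z _.
  by have := w0 z; case: (e y z) (e z x) => [] [].
have zy : z != y by apply: contraTneq yz => ->; rewrite e_irr.
have := w1; rewrite /walks3 (bigD1 y) // (bigD1 z) //= xy e_sym zx.
have := walks2_gt0 yz zx; rewrite e_sym in yz; rewrite e_sym in xy.
by have := walks2_gt0 yz xy; lia.
Qed.

End DefectMatrix.

Local Open Scope ring_scope.

(** * Matrix identities for the adjacency matrix *)

Section DefectGraph.

Variables (n : nat) (e : rel 'I_n.+1).
Hypotheses (e_sym : symmetric e) (e_irr : irreflexive e) (e3 : within3 e).
Hypothesis deg4 : forall x, degree e x = 4%N.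

Variable s : {perm 'I_n.+1}.
Hypothesis sE : forall x y, defect e x y = ((s x == y) + (s y == x))%N.

Section Ring.

Variable R : fieldType.

Definition adj_mx : 'M[R]_n.+1 := \matrix_(i, j) (e i j)%:R.

Lemma adj_mx_eq :
  adj_mx ^+ 3 + adj_mx ^+ 2 - 6%:R *: adj_mx - 3%:R%:M = const_mx 1 + cycle_mx R s.
Proof.
have A2 i j : (adj_mx ^+ 2) i j = (walks2 e i j)%:R.
  by rewrite mxE natr_sum; apply: eq_bigr => k _; rewrite !mxE natrM.
have A3 i j : (adj_mx ^+ 3) i j = (walks3 e i j)%:R.
  rewrite exprS mxE natr_sum; apply: eq_bigr => k _.
  by rewrite A2 mxE natrM.
apply/matrixP => i j.
have E : (walks3 e i j)%:R + (walks2 e i j)%:R = (s i == j)%:R + (s j == i)%:R +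
    (6%:R * (e i j)%:R + 3%:R * (i == j)%:R + 1%:R) :> R.
  by rewrite -!natrM -!natrD -sE defectE.
have -> : (adj_mx ^+ 3 + adj_mx ^+ 2 - 6%:R *: adj_mx - 3%:R%:M) i j =
    (adj_mx ^+ 3) i j + (adj_mx ^+ 2) i j - 6%:R * (e i j)%:R - 3%:R *+ (i == j).
  by rewrite !mxE.
have -> : (const_mx 1 + cycle_mx R s) i j = 1 + ((s i == j)%:R + (s j == i)%:R).
  by rewrite !mxE -[(s^-1)%g i == j](inj_eq (@perm_inj _ s)) permKV [i == _]eq_sym.
by rewrite A2 A3 E -mulr_natr; ring.
Qed.

Lemma adj_mx_const : adj_mx *m const_mx 1 = 4%:R *: const_mx 1 :> 'cV_n.+1.
Proof.
apply/colP => i; rewrite !mxE mulr1 -(sum_adj deg4 i) natr_sum.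
by apply: eq_bigr => k _; rewrite !mxE mulr1.
Qed.

Lemma adj_mx_comm_const : adj_mx *m const_mx 1 = const_mx 1 *m adj_mx :> 'M_n.+1.
Proof.
apply/matrixP => i j; rewrite !mxE.
transitivity (4%:R : R).
  by rewrite -(sum_adj deg4 i) natr_sum; apply: eq_bigr => k _; rewrite !mxE mulr1.
rewrite -(sum_adj deg4 j) natr_sum; apply: eq_bigr => k _.
by rewrite !mxE mul1r e_sym.
Qed.

End Ring.

(** This compares entries of [A B = B A] over [rat], where natural numbers embed injectively. *)
Lemma adj_wave x y :
  (e (s x) y + e ((s^-1)%g x) y = e x (s y) + e x ((s^-1)%g y))%N.
Proof.
have := comm_adj_cycle_mx (adj_mx_comm_const rat) (adj_mx_eq rat).
rewrite mulmxDl mulmxDr => /matrixP/(_ x y).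
have -> : adj_mx rat *m perm_mx s = col_perm s^-1 (adj_mx rat).
  by rewrite col_permE invgK.
rewrite -col_permE -!row_permE !mxE -!natrD => /eqP.
by rewrite Num.Theory.eqr_nat addnC => /eqP->.
Qed.

End DefectGraph.

Local Close Scope ring_scope.

(** * Numerical certificates and the final count *)

(* Modulo the prime [l], [z] has order [d] and inverse [z'], and the cubic
   [x^3 + x^2 - 6 x - 3 = z + z'] has no root. *)
Definition certificate d l z z' : bool :=
  [&& prime l, 51 < l, z * z' == 1 %[mod l],
      all (fun k => (iter k (fun x => x * z %% l) 1 == 1) == (d %| k)) (iota 1 51)
    & all (fun x => (x * x %% l) * (x + 1) != 6 * x + 3 + (z + z') %[mod l])
        (iota 0 l)].

(** These [d] are the ones left by the other two arguments: [2^i 3^j 17^k] up to 51 with [j <= 1].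
    Each [l] is 1 modulo [d], so that its prime field has elements of order [d]. *)
Definition certificates : seq (nat * nat * nat * nat) :=
  [:: (1, 53, 1, 1); (2, 59, 58, 58); (3, 151, 32, 118); (4, 109, 33, 76);
      (6, 61, 14, 48); (8, 73, 10, 22); (12, 73, 3, 49); (16, 97, 12, 89);
      (17, 103, 30, 79); (24, 97, 9, 54); (32, 97, 28, 52); (34, 103, 10, 31);
      (48, 97, 3, 65); (51, 103, 17, 97)].

Lemma certificatesP :
  all (fun c => let: (d, l, z, z') := c in certificate d l z z') certificates.
Proof. by vm_compute. Qed.

Lemma divisor_cases d : d <= 51 ->
  [|| 3 %| totient d,
      has (fun q => [&& prime q, 4 < q, ~~ (q %| 51) & q %| d]) (iota 0 52)
    | d \in [seq c.1.1.1 | c <- certificates]].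
Proof.
move=> d51; pose P d := [|| 3 %| totient d,
  has (fun q => [&& prime q, 4 < q, ~~ (q %| 51) & q %| d]) (iota 0 52)
  | d \in [seq c.1.1.1 | c <- certificates]].
suff /allP allP52 : all P (iota 0 52) by apply: allP52; rewrite mem_iota.
by vm_compute.
Qed.

Local Open Scope ring_scope.

Lemma Fp_natr_eq l (m k : nat) : prime l ->
  (m%:R == k%:R :> 'F_l) = (m == k %[mod l])%N.
Proof. by move=> l_pr; rewrite -val_eqE /= !val_Fp_nat. Qed.

Section Counting.

Variables (e : rel 'I_51).
Hypotheses (e_sym : symmetric e) (e_irr : irreflexive e) (e3 : within3 e).
Hypotheses (deg4 : forall x, degree e x = 4%N).
Variable s : {perm 'I_51}.
Hypothesis sE : forall x y, defect e x y = ((s x == y) + (s y == x))%N.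

Lemma certificate_three_dvd d l z z' : certificate d l z z' ->
  (3 %| #|cycles_dvd s d| - (d == 1%N))%N.
Proof.
case/and5P=> l_pr l51 zz1 /allP ord /allP no_root.
have l1 : (1 < l)%N by apply: prime_gt1.
have small k : (0 < k <= 51)%N -> k%:R != 0 :> 'F_l.
  case/andP=> k0 k51; rewrite (Fp_natr_eq k 0 l_pr) mod0n modn_small -?lt0n //.
  exact: leq_ltn_trans l51.
have iterE k : iter k (fun x => x * z %% l)%N 1%N = (z ^ k %% l)%N.
  elim: k => [|k IH]; first by rewrite modn_small.
  by rewrite iterS IH modnMml expnSr.
apply: (@three_dvd_cycles_dvd 'F_l 50 s _ (adj_mx_comm_const e_sym deg4 _)
  (adj_mx_const deg4 _) (adj_mx_eq e_sym e_irr e3 deg4 sE _) small z%:R z'%:R).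
- move=> k k51; have /ord/eqP <- : k \in iota 1 51 by rewrite mem_iota; lia.
  by rewrite iterE -natrX (Fp_natr_eq _ 1 l_pr) [(1 %% l)%N]modn_small.
- by apply/eqP; rewrite -natrM (Fp_natr_eq _ 1 l_pr).
(* The cubic without subtractions, as [certificate] tests it on natural numbers. *)
have alg (R : comNzRingType) (y c : R) : y ^+ 3 + y ^+ 2 - 6%:R * y - 3%:R = c ->
  y * y * (y + 1) = 6%:R * y + 3%:R + c by move=> <-; ring.
move=> x; rewrite -(natr_Zp x); set m := nat_of_ord x.
have /no_root : m \in iota 0 l.
  by rewrite mem_iota /= add0n -[X in (_ < X)%N](Fp_cast l_pr) ltn_ord.
have -> : ((m * m %% l) * (m + 1) == 6 * m + 3 + (z + z') %[mod l])%N =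
    (m%:R * m%:R * (m%:R + 1%:R) == 6%:R * m%:R + 3%:R + (z%:R + z'%:R) :> 'F_l).
  by rewrite -!natrM -!natrD -natrM Fp_natr_eq // modnMml.
by apply: contra => /eqP E; apply/eqP/alg.
Qed.

Lemma no_cycle_lengths : False.
Proof.
have T51 : #|'I_51| = 51%N by rewrite card_ord.
have wave := adj_wave e_sym e_irr e3 deg4 sE.
(* The subtraction in [certificate_three_dvd] is truncated, so [N_1 = 1 mod 3] follows only once
   [N_1 > 0]. *)
have N1 : (0 < #|cycles_dvd s 1|)%N.
  rewrite card_gt0; apply/set0Pn; exists (froot s ord0).
  rewrite inE dvd1n andbT; apply: roots_root.
  exact/fconnect_sym/perm_inj.
have main (d : 'I_52) : (totient d * #|cycles_dvd s d| = (d == 1 :> nat) %[mod 3])%N.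
  have d51 : (d <= 51)%N by rewrite -ltnS.
  case/or3P: (divisor_cases d51) => [d3|/hasP[q _ /and4P[q_pr q4 q51 qd]]|/mapP[c cC dc]].
  - have d1 : (d == 1 :> nat) = false by apply: contraTF d3 => /eqP->.
    by rewrite d1 mod0n; apply/eqP/dvdn_mulr.
  - have d1 : (d == 1 :> nat) = false.
      by apply: contraTF qd => /eqP->; rewrite dvdn1; case: (q) q4 => [|[]].
    rewrite d1; suff -> : cycles_dvd s d = set0 by rewrite cards0 muln0.
    apply/setP => r; rewrite !inE; apply: contraNF q51 => /andP[_ dr].
    have deg_le4 x : (degree e x <= 4)%N by rewrite deg4.
    have := prime_dvd_cycles e_sym wave deg_le4 e3 q_pr q4 (dvdn_trans qd dr).
    by rewrite T51.
  - have := allP certificatesP _ cC; case: c cC dc => [[[d' l] z] z'] _ /= <-.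
    move/certificate_three_dvd; case: eqP => [->|_].
      rewrite (_ : totient 1 = 1%N) // mul1n.
      case: #|cycles_dvd s 1| N1 => // m _; rewrite subn1 /= => /eqP m0.
      by rewrite -[m.+1]addn1 -modnDml m0.
    by rewrite subn0 mod0n => /(dvdn_mull (totient d))/eqP.
(* Modulo 3 only the term [d = 1] survives, whereas 51 is 0. *)
have := congr1 (modn^~ 3) (sum_totient_cycles_dvd s); rewrite T51 /=.
rewrite -modn_summ (eq_bigr _ (fun d _ => main d)) modn_summ.
rewrite (bigD1 (Ordinal (isT : (1 < 52)%N))) //= big1 // => d.
by rewrite -val_eqE /= => /negPf->.
Qed.

End Counting.

Local Close Scope ring_scope.

(** Matrices are indexed by ordinals, so the graph is copied onto ['I_51]. *)
Lemma no_regular_within3_51 (T : finType) (e : rel T) :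
  symmetric e -> irreflexive e -> within3 e -> (forall x, degree e x = 4) ->
  #|T| <> 51.
Proof.
move=> e_sym e_irr e3 deg4 T51.
pose f (i : 'I_51) : T := enum_val (cast_ord (esym T51) i).
pose g x := cast_ord T51 (enum_rank x).
have gK : cancel g f by move=> x; rewrite /f /g cast_ordK enum_rankK.
have f_inj : injective f by move=> i j /enum_val_inj/cast_ord_inj.
pose e' : rel 'I_51 := fun i j => e (f i) (f j).
have e'_sym : symmetric e' by move=> i j; apply: e_sym.
have e'_irr : irreflexive e' by move=> i; apply: e_irr.
have e'3 : within3 e'.
  move=> i j; rewrite /e'.
  case: (e3 (f i) (f j)) => [/f_inj ->|ij|[a ia aj]|[a [b [ia ab bj]]]].
  - by constructor 1.
  - by constructor 2.
  - by constructor 3; exists (g a); rewrite gK.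
  - by constructor 4; exists (g a), (g b); rewrite !gK.
have deg4' i : degree e' i = 4.
  transitivity (degree e (f i)); last exact: deg4.
  rewrite /degree -(card_imset _ f_inj); apply: eq_card => y.
  rewrite inE; apply/imsetP/idP => [[j]|iy]; first by rewrite inE => ij ->.
  by exists (g y); rewrite ?gK // inE /e' gK.
have sum2 i : \sum_j defect e' i j = 2.
  by apply: sum_defect => //; apply: card_ord.
have [s sE] := orient_2regular (defect_sym e'_sym) sum2 (defect_diag e'_sym e'_irr e'3 deg4').
exact: (no_cycle_lengths e'_sym e'_irr e'3 deg4' sE).
Qed.

Theorem theorem6p4 : ~ exists (T : finType) (e : rel T), defect_graph 4 3 2 e.
Proof.
case=> T [e [[e_sym e_irr] max4 diam3]]; rewrite moore_bound_4_3 => card53.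
have T51 : #|T| = 51 by lia.
have e3 := diameter3_within3 diam3.
have deg_le4 x : degree e x <= 4.
  by rewrite -max4 /max_degree (bigD1 x) //= leq_maxl.
apply: (no_regular_within3_51 e_sym e_irr e3 _ T51).
by apply: within3_regular; rewrite ?T51.
Qed.
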